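(* For all integers $n,k\ge0$, $\sum_{\lambda\in\widetilde{\mathcal{T}}_n^k}x^{w_{\widetilde{\mathcal{T}}}^{\leftarrow}(\lambda)}=\sum_{\lambda\in\widetilde{\mathcal{T}}_n^k}x^{w_{\widetilde{\mathcal{T}}}^{\downarrow}(\lambda)}$.
   Context: $\widetilde{\mathcal{T}}_n^k$ (packed alternative tableaux of rectangular shape $n\times k$): partial fillings of the cells of an $(n+1)\times(k+1)$ rectangle with left arrows $\leftarrow$ and down arrows $\downarrow$ such that every cell pointed to by an arrow (strictly left of a $\leftarrow$ in its row, or strictly below a $\downarrow$ in its column) is empty, each row except the bottom row contains exactly one $\leftarrow$, each column except the leftmost column contains exactly one $\downarrow$, the bottom row contains no $\leftarrow$, and the leftmost column contains no $\downarrow$. $w_{\widetilde{\mathcal{T}}}^{\leftarrow}(\lambda)$ is the number of columns that contain a $\leftarrow$ and whose $\downarrow$ lies in the bottom row; $w_{\widetilde{\mathcal{T}}}^{\downarrow}(\lambda)$ is the number of rows that contain a $\downarrow$ and whose $\leftarrow$ lies in the leftmost column. *)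

(* Defs.v *)
From HB Require Import structures.
From mathcomp Require Import all_boot all_order all_algebra.

Set Implicit Arguments.
Unset Strict Implicit.
Unset Printing Implicit Defensive.

Inductive arrow : Type := LeftArrow | DownArrow.

Definition bool_of_arrow (a : arrow) : bool :=
  if a is LeftArrow then true else false.

Definition arrow_of_bool (b : bool) : arrow :=
  if b then LeftArrow else DownArrow.

Lemma bool_of_arrowK : cancel bool_of_arrow arrow_of_bool.
Proof. by case. Qed.

HB.instance Definition _ := Finite.copy arrow (can_type bool_of_arrowK).

(* Row 0 is the top row and row [ord_max] the bottom one; column 0 is the
   leftmost one.  Hence a cell lies strictly below another cell of its column
   when its row index is larger.  [None] is an empty cell. *)
Notation filling n k := 'M[option arrow]_(n.+1, k.+1).

Section PackedTableaux.

Variables n k : nat.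
Implicit Types T : filling n k.

Definition pointed_cells_empty T : bool :=
  [forall i, forall j, forall j' : 'I_k.+1,
     (T i j == Some LeftArrow) && (j' < j) ==> (T i j' == None)]
  && [forall i, forall j, forall i' : 'I_n.+1,
        (T i j == Some DownArrow) && (i < i') ==> (T i' j == None)].

Definition row_arrows (a : arrow) T (i : 'I_n.+1) : {set 'I_k.+1} :=
  [set j | T i j == Some a].

Definition col_arrows (a : arrow) T (j : 'I_k.+1) : {set 'I_n.+1} :=
  [set i | T i j == Some a].

Definition is_packed_tableau T : bool :=
  [&& pointed_cells_empty T,
      [forall i, (i != ord_max) ==> (#|row_arrows LeftArrow T i| == 1)],
      [forall j, (j != ord0) ==> (#|col_arrows DownArrow T j| == 1)],
      row_arrows LeftArrow T ord_max == set0
    & col_arrows DownArrow T ord0 == set0].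

Definition w_left T : nat :=
  #|[set j | (col_arrows LeftArrow T j != set0)
             && (T ord_max j == Some DownArrow)]|.

Definition w_down T : nat :=
  #|[set i | (row_arrows DownArrow T i != set0)
             && (T i ord0 == Some LeftArrow)]|.

End PackedTableaux.

Definition packed_tableaux (n k : nat) : {set filling n k} :=
  [set T | is_packed_tableau T].

(* Main.v *)
Require Import Defs.
From mathcomp Require Import all_boot all_order all_algebra.
From Stdlib Require Import FunctionalExtensionality.

Set Implicit Arguments.
Unset Strict Implicit.
Unset Printing Implicit Defensive.

Import GRing.Theory.
Local Open Scope ring_scope.

(** Number the rows from the bottom and read "the arrow of row i lies in
    column j" as "column j is the parent of row i", and dually for columns.
    A packed tableau becomes a forest with the two roots row 0 and column 0,
    in which every vertex exceeds its grandparent.  In the tree hanging from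
    a non-leaf child c of a root, c is the least vertex of its colour, and the
    least vertex c' of the other colour is the least child of c; so the tree
    may be rerooted at c' and hung from the other root.  Doing this to all
    non-leaf children of both roots is an involution which exchanges the two
    statistics. *)

(** * Two-rooted bipartite forests and their rerooting edges *)

Section Forests.

Local Open Scope nat_scope.

(** Exchanges the two colours: every fact about [L] and [D] is reused for [tr D] and [tr L]. As
    [tr (tr L)] is convertible to [L], doing this twice costs nothing. *)
Definition tr {A B C : Type} (R : A -> B -> C) (b : B) (a : A) : C := R a b.

(* [L i j]: the parent of row [i] is column [j]; [D i j]: the parent of column
   [j] is row [i]. *)
Record forest {m k : nat} (L D : 'I_m.+1 -> 'I_k.+1 -> bool) : Prop := Forest {
  forest_root : forall j, ~~ L ord0 j;
  forest_uniq : forall i j j', L i j -> L i j' -> j = j';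
  forest_parent : forall i, i != ord0 -> exists j, L i j;
  forest_lt : forall i j j', L i j -> D i j' -> j < j';
  forest_root_tr : forall i, ~~ D i ord0;
  forest_uniq_tr : forall j i i', D i j -> D i' j -> i = i';
  forest_parent_tr : forall j, j != ord0 -> exists i, D i j;
  forest_lt_tr : forall j i i', D i j -> L i' j -> i < i'
}.

Lemma forest_sym {m k : nat} {L D : 'I_m.+1 -> 'I_k.+1 -> bool} :
  forest L D -> forest (tr D) (tr L).
Proof. by case=> *; split. Qed.

(* Column [j] is a non-leaf child of the root row, and row [i] is its least
   child: [ij] is an edge at which a tree gets rerooted. *)
Definition top {m k : nat} (L D : 'I_m.+1 -> 'I_k.+1 -> bool) i j : bool :=
  [&& L i j, D ord0 j & [forall i' : 'I_m.+1, L i' j ==> (i <= i')]].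

(** The row parents after rerooting; the column parents are [tr (switch (tr D) (tr L))]. In order: a
    rerooted child of column 0 falls below its former least child, a least child below a child of
    row 0 moves up to column 0, and any other row stays in place. *)
Definition switch {m k : nat} (L D : 'I_m.+1 -> 'I_k.+1 -> bool) i j : bool :=
  [|| top (tr D) (tr L) j i,
      (j == ord0) && [exists j', top L D i j']
    | L i j && ~~ [exists j', top L D i j' || top (tr D) (tr L) j' i]].

Lemma topP {m k : nat} (L D : 'I_m.+1 -> 'I_k.+1 -> bool) i j :
  reflect [/\ L i j, D ord0 j & forall i' : 'I_m.+1, L i' j -> i <= i']
          (top L D i j).
Proof.
apply: (iffP and3P) => -[Lij D0j].
  by move/forallP=> mini; split=> // i'; exact/implyP.
by move=> mini; split=> //; apply/forallP => i'; apply/implyP/mini.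
Qed.

Lemma top_exists {m k : nat} (L D : 'I_m.+1 -> 'I_k.+1 -> bool) i j :
  L i j -> D ord0 j -> exists i', top L D i' j.
Proof.
move=> Lij D0j.
case: (arg_minnP (P := fun i' => L i' j) (fun i' : 'I_m.+1 => i' : nat) Lij).
by move=> i' Li'j mini'; exists i'; apply/topP.
Qed.

Lemma top_uniq_col {m k : nat} {L D : 'I_m.+1 -> 'I_k.+1 -> bool} i i' j :
  top L D i j -> top L D i' j -> i = i'.
Proof.
move=> /topP[Lij _ mini] /topP[Li'j _ mini'].
by apply/val_inj/eqP; rewrite eqn_leq mini //= mini'.
Qed.

(** * Row parents after rerooting *)

Section Switch.

Context {m k : nat} {L D : 'I_m.+1 -> 'I_k.+1 -> bool} (F : forest L D).
Implicit Types (i : 'I_m.+1) (j : 'I_k.+1).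

Lemma top_uniq_row i j j' : top L D i j -> top L D i j' -> j = j'.
Proof.
by move=> /topP[Lij _ _] /topP[Lij' _ _]; exact: (forest_uniq F Lij Lij').
Qed.

(** The only parent of [i] would be both column 0, a root, and a column that hangs from row 0. *)
Lemma top_disjoint i j j' : top L D i j -> ~~ top (tr D) (tr L) j' i.
Proof.
move=> /topP[Lij D0j _]; apply/negP => /topP[_ Li0 _].
move: D0j; rewrite (forest_uniq F Lij Li0).
exact/negP/(forest_root_tr F).
Qed.

Lemma switch_top i j :
  top L D i j -> forall j', switch L D i j' = (j' == ord0).
Proof.
move=> tij j'; rewrite /switch (negbTE (top_disjoint j' tij)) /=.
have -> : [exists j', top L D i j'] by apply/existsP; exists j.
have -> : [exists j', top L D i j' || top (tr D) (tr L) j' i].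
  by apply/existsP; exists j; rewrite tij.
by rewrite andbT andbF orbF.
Qed.

Lemma switch_top_tr i j :
  top (tr D) (tr L) j i -> forall j', switch L D i j' = (j' == j).
Proof.
move=> tji j'; rewrite /switch.
have -> : [exists j', top L D i j'] = false.
  by apply/existsP => -[j1 tij1]; have := top_disjoint j tij1; rewrite tji.
have -> : [exists j', top L D i j' || top (tr D) (tr L) j' i].
  by apply/existsP; exists j; rewrite tji orbT.
rewrite !andbF !orbF; apply/idP/eqP => [tj'i | -> //].
exact: (top_uniq_col tj'i tji).
Qed.

Lemma switch_notop i j :
  (forall j', ~~ top L D i j') -> (forall j', ~~ top (tr D) (tr L) j' i) ->
  switch L D i j = L i j.
Proof.
move=> noU noD; rewrite /switch (negbTE (noD j)) /=.
have -> : [exists j', top L D i j'] = false.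
  by apply/existsP => -[j1]; apply/negP.
have -> : [exists j', top L D i j' || top (tr D) (tr L) j' i] = false.
  by apply/existsP => -[j1]; rewrite (negbTE (noU j1)) (negbTE (noD j1)).
by rewrite andbF andbT.
Qed.

Variant row_spec i : Prop :=
| RowTop j of top L D i j & forall j', switch L D i j' = (j' == ord0)
| RowTopTr j of top (tr D) (tr L) j i & forall j', switch L D i j' = (j' == j)
| RowNoTop of forall j', ~~ top L D i j' & forall j', ~~ top (tr D) (tr L) j' i
    & forall j', switch L D i j' = L i j'.

Lemma rowP i : row_spec i.
Proof.
have [/existsP[j tij]|/existsPn noU] := boolP [exists j, top L D i j].
  exact: (RowTop tij (switch_top tij)).
have [/existsP[j tji]|/existsPn noD] :=
  boolP [exists j, top (tr D) (tr L) j i].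
  exact: (RowTopTr tji (switch_top_tr tji)).
by apply: RowNoTop => // j; exact: switch_notop.
Qed.

Lemma switch_root j : ~~ switch L D ord0 j.
Proof.
case: (rowP ord0) => [j' /topP[L0 _ _] _|j' /topP[_ L0 _] _|_ _ ->].
- by have := forest_root F j'; rewrite L0.
- by have := forest_root F ord0; rewrite [L _ _]L0.
exact: (forest_root F j).
Qed.

Lemma switch_uniq i j j' : switch L D i j -> switch L D i j' -> j = j'.
Proof.
case: (rowP i) => [j0 _ sE|j0 _ sE|_ _ sE]; rewrite !sE;
  [by move=> /eqP-> /eqP->..|exact: (forest_uniq F)].
Qed.

Lemma switch_parent i : i != ord0 -> exists j, switch L D i j.
Proof.
case: (rowP i) => [j0 _ sE _|j0 _ sE _|_ _ sE /(forest_parent F)[j Lij]].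
- by exists ord0; rewrite sE.
- by exists j0; rewrite sE.
by exists j; rewrite sE.
Qed.

End Switch.

Arguments rowP {m k L D} F i.

(** * Grandparent order and rerooting edges of the new forest *)

Section SwitchOrder.

Context {m k : nat} {L D : 'I_m.+1 -> 'I_k.+1 -> bool} (F : forest L D).
Implicit Types (i : 'I_m.+1) (j : 'I_k.+1).
Let F' := forest_sym F.

(** If [i] is rerooted, its new parent is column 0, smaller than any non-root, or its former least
    child, smaller than the children that remain. Otherwise the old order applies. *)
Lemma switch_lt i j j' :
  switch L D i j -> tr (switch (tr D) (tr L)) i j' -> j < j'.
Proof.
have n0 i1 j1 : L i1 j1 -> i1 != ord0.
  by apply: contraTneq => ->; exact: (forest_root F j1).
rewrite [tr (switch _ _) _ _]/tr.
case: (rowP F i) => [j0 _ sE|j0 tji sE|noU noD sE]; rewrite sE.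
- move=> /eqP-> sji; rewrite lt0n; apply: contraTneq sji => j'0.
  by rewrite (_ : j' = ord0) ?switch_root //; exact/val_inj.
- move=> /eqP->; have /topP[Dij0 Li0 minj0] := tji.
  case: (rowP F' j') => [i1 tj'i1 sE'|i1 ti1j' sE'|noU' _ sE']; rewrite sE'.
  + by move=> /eqP i0; have := n0 _ _ Li0; rewrite i0.
  + move=> /eqP ii1; rewrite -ii1 in ti1j'.
    by have := top_disjoint F j0 ti1j'; rewrite tji.
  (* [j'] was already a child of [i]; it is not the least one, [j0], since [j0] does not stay in
     place. *)
  + move=> Dij'; rewrite ltn_neqAle minj0 // andbT.
    by apply: contraTneq tji => /val_inj ->; exact: noU'.
move=> Lij; case: (rowP F' j') => [i1 _ sE'|i1 ti1j' sE'|_ _ sE']; rewrite sE'.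
- by move=> /eqP i0; have := n0 _ _ Lij; rewrite i0.
- by move=> /eqP ii1; rewrite -ii1 in ti1j';
  have := noU j'; rewrite [top _ _ _ _]ti1j'.
exact: (forest_lt F Lij).
Qed.

(** Reversing a rerooting edge yields a rerooting edge at the other root, and no others arise. This
    gives both the involution and the exchange of the statistics. *)
Lemma top_switch i j :
  top (switch L D) (tr (switch (tr D) (tr L))) i j = top (tr D) (tr L) j i.
Proof.
have n0 i1 j1 : D i1 j1 -> j1 != ord0.
  by apply: contraTneq => ->; exact: (forest_root_tr F i1).
apply/topP/idP => [[sij]|tji].
  rewrite [tr (switch _ _) _ _]/tr => s0j mini.
  have jn0 : j != ord0.
    by apply: contraTneq s0j => ->; exact: (switch_root F' ord0).
  have [//|noji] := boolP (top (tr D) (tr L) j i).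
  have Lij : L i j.
    move: sij; case: (rowP F i) => [j0 _ ->|j0 tj0i ->|_ _ -> //].
      by rewrite (negbTE jn0).
    by move=> /eqP jj0; rewrite jj0 tj0i in noji.
  (* [i] was already a child of [j]. If [j] was the least child of a rerooted [i1], then [i1] is now
     a child of [j] smaller than its former grandchild [i]. If [j] itself was rerooted, its parent
     is no longer row 0. If [j] stayed below row 0, it was a non-leaf there and had to be
     rerooted. *)
  case: (rowP F' j) => [i1 tji1 _|i1 ti1j sE|_ noD sE].
  - have /topP[Di1j _ _] := tji1.
    have := mini i1; rewrite (switch_top_tr F tji1) eqxx leqNgt.
    by rewrite (forest_lt_tr F Di1j Lij) => /(_ isT).
  - have /topP[Li1j _ _] := ti1j; move: s0j; rewrite sE => /eqP i10.
    by have := forest_root F j; rewrite {1}i10 [L _ _]Li1j.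
  - have D0j : D ord0 j by rewrite sE in s0j.
    have [i1 ti1j] := top_exists Lij D0j.
    by have := noD i1; rewrite [top _ _ _ _]ti1j.
have /topP[Dij Li0 minj] := tji; have jn0 := n0 _ _ Dij.
split.
- by rewrite (switch_top_tr F tji).
- by rewrite /tr (switch_top F' tji).
move=> i'; case: (rowP F i') => [j0 _ ->|j0 tj0i' ->|_ _ ->].
- by rewrite (negbTE jn0).
- move=> /eqP jj0; rewrite -jj0 in tj0i'; have /topP[Di'j _ _] := tj0i'.
  by rewrite (forest_uniq_tr F Dij Di'j).
(* The other children of [j] are old ones, hence former grandchildren of [i]. *)
by move=> Li'j; exact/ltnW/(forest_lt_tr F Dij Li'j).
Qed.

End SwitchOrder.

Lemma forest_switch {m k : nat} {L D : 'I_m.+1 -> 'I_k.+1 -> bool} :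
  forest L D -> forest (switch L D) (tr (switch (tr D) (tr L))).
Proof.
move=> F; have F' := forest_sym F; split.
- exact: (switch_root F).
- exact: (switch_uniq F).
- exact: (switch_parent F).
- exact: (switch_lt F).
- exact: (switch_root F').
- exact: (switch_uniq F').
- exact: (switch_parent F').
- move=> j i i'; exact: (switch_lt F').
Qed.

(** By [top_switch] the second rerooting reverses exactly the edges reversed by the first. *)
Lemma switchK {m k : nat} {L D : 'I_m.+1 -> 'I_k.+1 -> bool} :
  forest L D ->
  switch (switch L D) (tr (switch (tr D) (tr L))) =2 L.
Proof.
move=> F i j; have sF := forest_switch F.
have tE := top_switch F; have tE' := top_switch (forest_sym F).
case: (rowP F i) => [j0 tij0 _|j0 tj0i _|noU noD <-].
- have /topP[Lij0 _ _] := tij0.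
  rewrite (switch_top_tr sF (j := j0)); last exact: (etrans (tE' j0 i) tij0).
  apply/eqP/idP => [-> //|Lij]; exact: (forest_uniq F Lij Lij0).
- have /topP[_ Li0 _] := tj0i.
  rewrite (switch_top sF (j := j0)) ?tE //.
  apply/eqP/idP => [-> //|Lij]; exact: (forest_uniq F Lij Li0).
rewrite switch_notop // => j'; first by rewrite tE.
by rewrite (_ : top _ _ _ _ = top L D i j') ?noU //; exact: tE'.
Qed.

(** The rerooting edges form a matching, so they may be counted by either end. This is needed
    because a reversal exchanges the ends. *)
Lemma card_top {m k : nat} {L D : 'I_m.+1 -> 'I_k.+1 -> bool} :
  forest L D ->
  #|[set j | [exists i, top L D i j]]| = #|[set i | [exists j, top L D i j]]|.
Proof.
move=> F; pose P := [set p | top L D p.1 p.2].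
have -> : [set j | [exists i, top L D i j]] = snd @: P.
  apply/setP => j; rewrite inE; apply/existsP/imsetP => [[i tij]|[[i j']]].
    by exists (i, j); rewrite ?inE.
  by rewrite inE /= => tij ->; exists i.
have -> : [set i | [exists j, top L D i j]] = fst @: P.
  apply/setP => i; rewrite inE; apply/existsP/imsetP => [[j tij]|[[i' j]]].
    by exists (i, j); rewrite ?inE.
  by rewrite inE /= => tij ->; exists j.
rewrite !card_in_imset // => -[i j] [i' j']; rewrite !inE /= => tij tij' E.
  by rewrite -E in tij' *; rewrite (top_uniq_row F tij tij').
by rewrite -E in tij' *; rewrite (top_uniq_col tij tij').
Qed.

End Forests.

(** * Packed tableaux as forests *)

Section Tableaux.

Local Open Scope nat_scope.
Context {n k : nat}.
Implicit Types (T : filling n k) (i : 'I_n.+1) (j : 'I_k.+1).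

Definition lefts T (i : 'I_n.+1) (j : 'I_k.+1) : bool :=
  T (rev_ord i) j == Some LeftArrow.

Definition downs T (i : 'I_n.+1) (j : 'I_k.+1) : bool :=
  T (rev_ord i) j == Some DownArrow.

Lemma rev_ord_max : rev_ord (@ord_max n) = ord0.
Proof. by apply: val_inj; rewrite /= subnn. Qed.

Lemma rev_ord_min : rev_ord (@ord0 n) = ord_max.
Proof. by rewrite -rev_ord_max rev_ordK. Qed.

Lemma ltn_rev_ord (i i' : 'I_n.+1) : (rev_ord i < rev_ord i') = (i' < i).
Proof. by rewrite /= !subSS ltn_sub2lE // -ltnS. Qed.

(** The emptiness of pointed cells splits into uniqueness of parents (arrows of one kind) and the
    grandparent order (arrows of different kinds); the order is strict because a cell holds one
    arrow at most. *)
Lemma packedP T : reflect (forest (lefts T) (downs T)) (is_packed_tableau T).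
Proof.
apply: (iffP and5P) => [[/andP[/forallP P1 /forallP P2] /forallP P3 /forallP P4
                          /eqP P5 /eqP P6] | F].
  have {}P1 i j j' : T i j == Some LeftArrow -> j' < j -> T i j' = None.
    move=> Tij lt; apply/eqP.
    by move/forallP: (P1 i) => /(_ j)/forallP/(_ j'); rewrite Tij lt.
  have {}P2 i j i' : T i j == Some DownArrow -> i < i' -> T i' j = None.
    move=> Tij lt; apply/eqP.
    by move/forallP: (P2 i) => /(_ j)/forallP/(_ i'); rewrite Tij lt.
  split.
  - by move=> j; move/setP: P5 => /(_ j); rewrite !inE /lefts rev_ord_min => ->.
  - move=> i j j' Lij Lij'; apply/val_inj.
    case: (ltngtP j j') => // lt.
      by have := P1 _ _ _ Lij' lt; rewrite (eqP Lij).
    by have := P1 _ _ _ Lij lt; rewrite (eqP Lij').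
  - move=> i i0; have := P3 (rev_ord i).
    rewrite -(inj_eq rev_ord_inj) rev_ordK rev_ord_max i0 /= => /cards1P[j E].
    by exists j; move/setP: E => /(_ j); rewrite !inE eqxx.
  - move=> i j j' Lij Dij'; case: (ltngtP j j') => // [lt|/val_inj E].
      by have := P1 _ _ _ Lij lt; rewrite (eqP Dij').
    by move: Dij'; rewrite -E /downs (eqP Lij).
  - by move=> i; move/setP: P6 => /(_ (rev_ord i)); rewrite !inE /downs => ->.
  - move=> j i i' Dij Di'j; apply/rev_ord_inj/val_inj.
    case: (ltngtP (rev_ord i) (rev_ord i')) => // lt.
      by have := P2 _ _ _ Dij lt; rewrite (eqP Di'j).
    by have := P2 _ _ _ Di'j lt; rewrite (eqP Dij).
  - move=> j j0; have := P4 j; rewrite j0 /= => /cards1P[i E].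
    exists (rev_ord i); rewrite /downs rev_ordK.
    by move/setP: E => /(_ i); rewrite !inE eqxx.
  - move=> j i i' Dij Li'j; case: (ltngtP i i') => // [lt|/val_inj E].
      rewrite -ltn_rev_ord in lt.
      by have := P2 _ _ _ Dij lt; rewrite (eqP Li'j).
    by move: Li'j; rewrite -E /lefts (eqP Dij).
have TL i j : T i j == Some LeftArrow = lefts T (rev_ord i) j.
  by rewrite /lefts rev_ordK.
have TD i j : T i j == Some DownArrow = downs T (rev_ord i) j.
  by rewrite /downs rev_ordK.
split.
(* An arrow in a pointed cell contradicts uniqueness if it is of the same kind, and the order if it
   is of the other kind. *)
- apply/andP; split; apply/forallP => i; apply/forallP => j; apply/forallP.
    move=> j'; apply/implyP => /andP[]; rewrite TL => Lij lt.
    case E: (T i j') => [[]|] //; move/eqP: E; rewrite ?TL ?TD => E.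
      by rewrite (forest_uniq F Lij E) ltnn in lt.
    by have := ltn_trans lt (forest_lt F Lij E); rewrite ltnn.
  move=> i'; apply/implyP => /andP[]; rewrite TD -ltn_rev_ord => Dij lt.
  case E: (T i' j) => [[]|] //; move/eqP: E; rewrite ?TL ?TD => E.
    by have := ltn_trans lt (forest_lt_tr F Dij E); rewrite ltnn.
  by rewrite (forest_uniq_tr F Dij E) ltnn in lt.
- apply/forallP => i; apply/implyP => i0.
  have [|j Lij] := forest_parent F (i := rev_ord i).
    by rewrite -rev_ord_max (inj_eq rev_ord_inj).
  apply/cards1P; exists j; apply/setP => j'; rewrite !inE TL.
  apply/idP/eqP => [Lij'|-> //]; exact: (forest_uniq F Lij' Lij).
- apply/forallP => j; apply/implyP => j0.
  have [i Dij] := forest_parent_tr F j0.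
  apply/cards1P; exists (rev_ord i); apply/setP => i'; rewrite !inE TD.
  apply/idP/eqP => [Di'j|->]; last by rewrite rev_ordK.
  by rewrite (forest_uniq_tr F Dij Di'j) rev_ordK.
- apply/eqP/setP => j; rewrite !inE TL rev_ord_max.
  exact/negbTE/(forest_root F).
apply/eqP/setP => i; rewrite !inE TD; exact/negbTE/(forest_root_tr F).
Qed.

(** [w_left] counts the non-leaf children of row 0, and a non-leaf is a column with a least
    child. *)
Lemma w_leftE T :
  w_left T = #|[set j | [exists i, top (lefts T) (downs T) i j]]|.
Proof.
apply: eq_card => j; rewrite !inE; apply/andP/existsP => [[/set0Pn[i]]|[i]].
  rewrite inE => Tij T0j; apply: (top_exists (i := rev_ord i)).
    by rewrite /lefts rev_ordK.
  by rewrite /downs rev_ord_min.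
move=> /topP[Lij D0j _]; split; last by rewrite /downs rev_ord_min in D0j.
by apply/set0Pn; exists (rev_ord i); rewrite inE.
Qed.

Lemma w_downE T :
  w_down T = #|[set i | [exists j, top (tr (downs T)) (tr (lefts T)) j i]]|.
Proof.
(* The forest numbers the rows from the bottom, the tableau from the top. *)
rewrite -(card_imset _ rev_ord_inj).
apply: eq_card => i; rewrite inE; apply/andP/imsetP => [[/set0Pn[j]]|[i']].
  rewrite inE => Tij Ti0; exists (rev_ord i); last by rewrite rev_ordK.
  rewrite inE; apply/existsP; apply: (top_exists (i := j)).
    by rewrite /tr /downs rev_ordK.
  by rewrite /tr /lefts rev_ordK.
rewrite inE => /existsP[j /topP[Dij Li0 _]] ->; split=> //.
by apply/set0Pn; exists j; rewrite inE.
Qed.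

(** * The involution on tableaux *)

Definition flip T : filling n k :=
  \matrix_(i, j)
    if switch (lefts T) (downs T) (rev_ord i) j then Some LeftArrow
    else if switch (tr (downs T)) (tr (lefts T)) j (rev_ord i)
    then Some DownArrow else None.

Lemma tableau_ext T T' :
  lefts T =2 lefts T' -> downs T =2 downs T' -> T = T'.
Proof.
move=> EL ED; apply/matrixP => i j.
move: (EL (rev_ord i) j) (ED (rev_ord i) j); rewrite /lefts /downs rev_ordK.
by case: (T i j) (T' i j) => [[]|] [[]|].
Qed.

(** Stated as an equality of functions, so that it rewrites inside [switch], [top] and [forest]. *)
Lemma lefts_flip T : lefts (flip T) = switch (lefts T) (downs T).
Proof.
apply: functional_extensionality => i; apply: functional_extensionality => j.
by rewrite /lefts mxE rev_ordK; case: ifP => // _; case: ifP.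
Qed.

Lemma downs_flip T :
  forest (lefts T) (downs T) ->
  downs (flip T) = tr (switch (tr (downs T)) (tr (lefts T))).
Proof.
move=> F.
apply: functional_extensionality => i; apply: functional_extensionality => j.
rewrite /downs mxE rev_ordK -/(lefts T) -/(downs T) [RHS]/tr.
case: ifP => [sij|_]; last by case: ifP.
(* The precedence of left arrows in [flip] loses no down arrow: a cell claimed by both would give
   [j < j]. *)
by apply/esym/negP => /(switch_lt F sij); rewrite ltnn.
Qed.

Lemma flip_packed T : is_packed_tableau T -> is_packed_tableau (flip T).
Proof.
move=> /packedP F; apply/packedP.
by rewrite lefts_flip downs_flip //; exact: forest_switch.
Qed.

Lemma flipK T : is_packed_tableau T -> flip (flip T) = T.
Proof.
move=> pT; have /packedP F := pT; have /packedP sF := flip_packed pT.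
apply: tableau_ext => i j.
  by rewrite lefts_flip lefts_flip downs_flip // switchK.
rewrite downs_flip // lefts_flip downs_flip //.
exact: (switchK (forest_sym F)).
Qed.

Lemma w_left_flip T : is_packed_tableau T -> w_left (flip T) = w_down T.
Proof.
move=> /packedP F; rewrite w_leftE w_downE lefts_flip downs_flip //.
rewrite (card_top (forest_sym F)).
by apply: eq_card => j; rewrite !inE; apply: eq_existsb => i; rewrite top_switch.
Qed.

End Tableaux.

Theorem theorem5p1 (n k : nat) :
  \sum_(T in packed_tableaux n k) 'X^(w_left T)
  = \sum_(T in packed_tableaux n k) 'X^(w_down T) :> {poly int}.
Proof.
rewrite (reindex_onto flip flip) => [|T]; last by rewrite inE; exact: flipK.
apply: eq_big => [T|T /andP[]].
  (* The reindexed sum ranges over the [T] with [flip T] packed and [flip (flip T) = T]; these are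
     exactly the packed ones. *)
  rewrite !inE; apply/andP/idP => [[pT /eqP <-]|pT]; first exact: flip_packed.
  by rewrite flip_packed // flipK.
by rewrite inE => /flip_packed pT /eqP fK; rewrite fK in pT; rewrite w_left_flip.
Qed.
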